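(* Let $d\ge2$, let $|\psi_{id}\rangle\in\mathbb{C}^d$ be a unit vector, $\rho_{id}=|\psi_{id}\rangle\langle\psi_{id}|$, and let $\rho$ be a density matrix on $\mathbb{C}^d$ with arrowhead representation having off-diagonal part $C$. Let $F=\langle\psi_{id}|\rho|\psi_{id}\rangle$ and let $\sigma\ge0$ be defined by $$\sigma^2=\mathrm{Var}[\rho]=\langle\psi_{id}|\rho^2|\psi_{id}\rangle-F^2 .$$ Then $C$ and the commutator $[\rho_{id},\rho]$ have (at most) two nonzero eigenvalues: counted with multiplicity, the eigenvalues of $C$ are $+\sigma,-\sigma$ and $0$ ($d-2$ times), and the eigenvalues of $[\rho_{id},\rho]$ are $+i\sigma,-i\sigma$ and $0$ ($d-2$ times). Consequently, for all $0<p\le\infty$, $$\lVert[\rho_{id},\rho]\rVert_p=\lVert C\rVert_p=2^{1/p}\sigma .$$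
   Context: A density matrix is a positive semidefinite complex matrix of trace one. $\lVert\cdot\rVert_p$ is the Schatten $p$-(quasi)norm, i.e. the $\ell_p$ (quasi)norm of the vector of singular values, with $\lVert\cdot\rVert_\infty$ the operator norm and $2^{1/\infty}=1$. Arrowhead representation: choose an orthonormal basis $|\psi_{id}\rangle,|\phi_2\rangle,\dots,|\phi_d\rangle$ where the $|\phi_k\rangle$ are eigenvectors of $P\rho P$, $P=\mathrm{Id}-\rho_{id}$, with phases chosen so that $C_k:=\langle\psi_{id}|\rho|\phi_k\rangle\ge0$. In this basis $\rho$ is the matrix $\tilde\rho$ with $(1,1)$ entry $F$, diagonal entries $D_k=\langle\phi_k|\rho|\phi_k\rangle$ ($k=2,\dots,d$), entries $C_k$ at positions $(1,k)$ and $(k,1)$, and zeros elsewhere. $C$ is the $d\times d$ matrix with entries $C_k$ at positions $(1,k)$ and $(k,1)$, $k=2,\dots,d$, and zeros elsewhere. *)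

(* Defs.v *)
From mathcomp Require Import all_boot all_order all_algebra.
From mathcomp Require Import complex.
From mathcomp Require Import boolp classical_sets reals constructive_ereal exp.

Set Implicit Arguments.
Unset Strict Implicit.
Unset Printing Implicit Defensive.

Import Order.TTheory GRing.Theory Num.Theory.
Local Open Scope ring_scope.
Local Open Scope sesquilinear_scope.
Local Open Scope complex_scope.
Local Open Scope classical_set_scope.

Section Defs.
Variables (R : realType) (d : nat).
Implicit Types (A rho U : 'M[R[i]]_d) (u v psi : 'cV[R[i]]_d).

(* <u|A|v>, antilinear in u *)
Definition braket u A v : R[i] := (u^t* *m A *m v) 0 0.

Definition norm2 v : R := Num.sqrt (complex.Re ((v^t* *m v) 0 0)).

Definition projector psi : 'M[R[i]]_d := psi *m psi^t*.

(* Over R[i] the order satisfies 0 <= z iff z is real and nonnegative. *)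
Definition psdmx A := A \is hermsymmx /\ forall v, 0 <= braket v A v.

Definition density_matrix rho := psdmx rho /\ \tr rho = 1.

Definition variance psi rho : R[i] :=
  braket psi (rho *m rho) psi - braket psi rho psi ^+ 2.

Definition commutator A B : 'M[R[i]]_d := A *m B - B *m A.

(* The columns of U are the basis psi, phi_2, ..., phi_d, numbered from 0. *)
Definition arrowhead_basis psi rho U :=
  let P := 1%:M - projector psi in
  [/\ U \is unitarymx,
      forall k : 'I_d, k = 0 :> nat -> col k U = psi,
      forall k : 'I_d, k <> 0 :> nat ->
        exists a : R[i], (P *m rho *m P) *m col k U = a *: col k U
    & forall k : 'I_d, k <> 0 :> nat -> 0 <= braket psi rho (col k U)].

Definition arrowhead_offdiag psi rho U : 'M[R[i]]_d :=
  \matrix_(j, k)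
    if (j == 0 :> nat) && (k != 0 :> nat) then braket psi rho (col k U)
    else if (j != 0 :> nat) && (k == 0 :> nat) then braket psi rho (col j U)
    else 0.

(* The roots of the characteristic polynomial, repeated according to
   multiplicity, in an unspecified order. *)
Definition eigenvalues A : seq R[i] :=
  sval (closed_field_poly_normal (char_poly A)).

Definition singular_values A : seq R :=
  [seq Num.sqrt (complex.Re z) | z <- eigenvalues (A^t* *m A)].

Definition operator_norm A : R :=
  sup [set norm2 (A *m v) | v in [set v | norm2 v = 1]].

(* Only meaningful for 0 < p; a quasinorm for p < 1. *)
Definition schatten (p : \bar R) A : R :=
  match p with
  | r%:E => (\sum_(s <- singular_values A) s `^ r) `^ r^-1
  | _ => operator_norm A
  end.

End Defs.

(* Main.v *)
Require Import Defs.
From mathcomp Require Import all_boot all_order all_algebra.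
From mathcomp Require Import complex.
From mathcomp Require Import boolp classical_sets reals constructive_ereal exp.
From mathcomp Require Import ring.

Import Order.TTheory GRing.Theory Num.Theory.
Local Open Scope ring_scope.
Local Open Scope complex_scope.

(** Both matrices have the shape [A = x w^* + e w x^*] with [x] a unit vector,
    [w] orthogonal to [x], [|w|^2 = sigma^2] and [|e| = 1]: for the commutator
    [x = psi], [w = rho psi - F psi], [e = -1]; for [C], [x] is the first
    coordinate vector, [w] the tail of the arrowhead and [e = 1].  Sylvester's
    identity [z^n det (z - B D) = z^m det (z - D B)] reduces the characteristic
    polynomials of [A] and of [A^* A = sigma^2 x x^* + w w^*] to those of 2 x 2
    matrices.  For the operator norm, [G = A^* A] satisfies [G^2 = sigma^2 G],
    so [|sigma^2 v - G v|^2 = sigma^2 (sigma^2 |v|^2 - |A v|^2)], whence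
    [|A v| <= sigma |v|], with equality at [v = x]. *)

(** * Sylvester's identity and characteristic polynomials of rank-two matrices *)

Lemma det_scalar_sub_mulmx_swap {R : comPzRingType} {m n : nat} (x : R)
    (B : 'M[R]_(m, n)) (D : 'M[R]_(n, m)) :
  x ^+ n * \det (x%:M - B *m D) = x ^+ m * \det (x%:M - D *m B).
Proof.
(* Evaluate [\det M] after clearing either off-diagonal block. *)
pose M := block_mx x%:M B D 1%:M.
pose L := block_mx 1%:M 0 (- D) 1%:M.
pose N := block_mx 1%:M (- B) 0 x%:M.
have detL : \det L = 1 by rewrite det_lblock !det1 mulr1.
have detN : \det N = x ^+ n by rewrite det_ublock det1 mul1r det_scalar.
have detM : \det M = \det (x%:M - B *m D).
  have <- : \det (M *m L) = \det M by rewrite det_mulmx detL mulr1.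
  rewrite mulmx_block !mulmx0 !mulmx1 !mul1mx addrN !add0r mulmxN.
  by rewrite det_ublock det1 mulr1.
rewrite -detM -detN mulrC -det_mulmx.
rewrite mulmx_block !mulmx0 !mulmx1 mul1mx !addr0 !mulmxN.
by rewrite -scalar_mxC addNr det_lblock det_scalar [_ + x%:M]addrC.
Qed.

Lemma char_poly_mulmx_swap {R : comNzRingType} {m n : nat}
    (B : 'M[R]_(m, n)) (D : 'M[R]_(n, m)) :
  'X^n * char_poly (B *m D) = 'X^m * char_poly (D *m B).
Proof.
by rewrite /char_poly /char_poly_mx !map_mxM det_scalar_sub_mulmx_swap.
Qed.

Lemma det_mx22 {R : comNzRingType} (M : 'M[R]_2) :
  \det M = M 0 0 * M 1 1 - M 0 1 * M 1 0.
Proof.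
rewrite (expand_det_row _ 0) !big_ord_recl big_ord0 /cofactor !det_mx11 !mxE.
rewrite /= addr0 expr0 expr1 mul1r mulN1r mulrN.
by do 3?[congr (_ * _ - _ * _ )]; congr (M _ _); apply: val_inj.
Qed.

Lemma det_block_mx11 {R : comNzRingType} (A B D E : 'M[R]_1) :
  \det (block_mx A B D E) = A 0 0 * E 0 0 - B 0 0 * D 0 0.
Proof.
have [i0 i1] : (0 : 'I_2) = @lshift 1 1 0 /\ (1 : 'I_2) = @rshift 1 1 0.
  by split; exact: val_inj.
rewrite det_mx22 i0 i1.
have -> := block_mxEul A B D E 0 0; have -> := block_mxEur A B D E 0 0.
by have -> := block_mxEdl A B D E 0 0; have -> := block_mxEdr A B D E 0 0.
Qed.

(** Reading [x *m a + y *m b] as [row_mx x y *m col_mx a b] and swapping the factors leaves the 2 x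
    2 matrix of the four pairings. *)
Lemma char_poly_rank2 {R : comNzRingType} {n : nat} (x y : 'cV[R]_n.+2)
    (a b : 'rV[R]_n.+2) (al be ga de : R) :
  a *m x = al%:M -> a *m y = be%:M -> b *m x = ga%:M -> b *m y = de%:M ->
  char_poly (x *m a + y *m b) =
  'X^n * (('X - al%:P) * ('X - de%:P) - (be * ga)%:P).
Proof.
move=> ax ay bx by_; have := char_poly_mulmx_swap (row_mx x y) (col_mx a b).
rewrite mul_row_col mul_col_row ax ay bx by_ (exprD _ 2 n) -mulrA.
(* [R] may have zero divisors; ['X^2] can still be cancelled because monic polynomials are
   regular. *)
have /monic_lreg lregX2 : 'X^2 \is @monic R by rewrite monicXn.
move=> /lregX2 ->; congr (_ * _).
rewrite /char_poly /char_poly_mx map_block_mx !map_scalar_mx scalar_mx_block.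
rewrite opp_block_mx add_block_mx det_block_mx11.
rewrite !mxE /= !mulr1n !add0r polyCM; ring.
Qed.

(** A factorization into monic linear factors is unique up to order, so the root list chosen in
    [eigenvalues] can be traded for an explicit one. *)
Lemma eigenvalues_perm_eq {R : realType} (d : nat) (A : 'M[R[i]]_d)
    (s : seq R[i]) :
  char_poly A = \prod_(z <- s) ('X - z%:P) -> perm_eq (eigenvalues A) s.
Proof.
rewrite /eigenvalues; case: closed_field_poly_normal => r /= ->.
by rewrite (monicP (char_poly_monic A)) scale1r => /prod_XsubC_eq.
Qed.

(** * Conjugate transposes and Euclidean norms *)

Local Open Scope sesquilinear_scope.

Lemma adjmxM {C : numClosedFieldType} {m n p : nat}
    (A : 'M[C]_(m, n)) (B : 'M[C]_(n, p)) : (A *m B)^t* = B^t* *m A^t*.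
Proof. by rewrite trmx_mul map_mxM. Qed.

Lemma adjmxD {C : numClosedFieldType} {m n : nat} (A B : 'M[C]_(m, n)) :
  (A + B)^t* = A^t* + B^t*.
Proof. by rewrite linearD map_mxD. Qed.

Lemma adjmxB {C : numClosedFieldType} {m n : nat} (A B : 'M[C]_(m, n)) :
  (A - B)^t* = A^t* - B^t*.
Proof. by rewrite linearB map_mxB. Qed.

Lemma adjmxZ {C : numClosedFieldType} {m n : nat} (c : C) (A : 'M[C]_(m, n)) :
  (c *: A)^t* = c^* *: A^t*.
Proof. by rewrite linearZ map_mxZ. Qed.

Lemma norm2_ge0 {R : realType} {d : nat} (v : 'cV[R[i]]_d) : 0 <= norm2 v.
Proof. exact: sqrtr_ge0. Qed.

(** The product is a sum of squared moduli, hence real and nonnegative, so the real part and the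
    square root in [norm2] lose nothing. *)
Lemma sqr_norm2 {R : realType} {d : nat} (v : 'cV[R[i]]_d) :
  v^t* *m v = ((norm2 v ^+ 2)%:C)%:M.
Proof.
rewrite [LHS]mx11_scalar; congr (_%:M).
have ge0 : 0 <= (v^t* *m v) 0 0.
  rewrite mxE sumr_ge0 // => k _; rewrite !mxE mulrC.
  by rewrite -normCK exprn_ge0.
move: ge0; rewrite /norm2 => ge0; rewrite sqr_sqrtr.
  by rewrite RRe_real // ger0_real.
by move: ge0; rewrite lecE => /andP[].
Qed.

Lemma adjmxM_eq0 {R : realType} {d : nat} (v : 'cV[R[i]]_d) :
  v^t* *m v = 0 -> v = 0.
Proof.
move=> /matrixP/(_ 0 0); rewrite !mxE => v0.
have ge0 k : true -> 0 <= v^t* 0 k * v k 0.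
  by move=> _; rewrite !mxE mulrC -normCK exprn_ge0.
apply/matrixP => k l; rewrite (ord1 l) mxE.
have := psumr_eq0P ge0 v0 (i := k) isT.
by rewrite !mxE mulrC -normCK => /eqP; rewrite expf_eq0 normr_eq0 => /eqP.
Qed.

Lemma powR_inv2 {R : realType} (r s : R) :
  0 < r -> 0 <= s -> (s `^ r + s `^ r) `^ r^-1 = 2 `^ r^-1 * s.
Proof.
move=> r0 s0; rewrite -mulr2n -[_ *+ 2 in LHS]mulr_natl powRM ?powR_ge0 //.
by rewrite -powRrM divff ?gt_eqF // powRr1.
Qed.

Lemma mulmx_mid {R : pzSemiRingType} {m n p q r : nat} (A : 'M[R]_(m, n))
    (B : 'M[R]_(n, p)) (D : 'M[R]_(p, q)) (E : 'M[R]_(q, r)) :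
  A *m B *m (D *m E) = A *m (B *m D) *m E.
Proof. by rewrite !mulmxA. Qed.

Lemma scalar_mx_inj1 {V : nmodType} : injective (@scalar_mx V 1).
Proof. by move=> a b /matrixP/(_ 0 0); rewrite !mxE !mulr1n. Qed.

(** On expansion, [G *m G = c *: G] makes the term quadratic in [G] cancel one of the two cross
    terms. For nonzero [c] this is Pythagoras for the projection [c^-1 *: G]. *)
Lemma sqr_scale_subM {C : numClosedFieldType} {m : nat} {c : C}
    {G : 'M[C]_m} (v : 'cV[C]_m) :
  Num.conj c = c -> G^t* = G -> G *m G = c *: G ->
  (c *: v - G *m v)^t* *m (c *: v - G *m v) =
  c *: (c *: (v^t* *m v) - v^t* *m G *m v).
Proof.
move=> cc Gherm GG; rewrite adjmxB adjmxZ cc adjmxM Gherm.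
rewrite mulmxBl !mulmxBr -!scalemxAl -!scalemxAr.
rewrite !mulmxA -(mulmxA _ G G) GG -scalemxAr -scalemxAl -scalerBr.
by rewrite [X in _ - X]subrr subr0.
Qed.

(** * Spectrum, singular values and norms of [x w^* + e w x^*] *)

Section RankTwo.
Context {R : realType} {n : nat} {x w : 'cV[R[i]]_n.+2} {s : R} {e : R[i]}.
Hypothesis xx : x^t* *m x = 1%:M.
Hypothesis xw : x^t* *m w = 0.
Hypothesis ww : w^t* *m w = ((s ^+ 2)%:C)%:M.
Hypothesis s_ge0 : 0 <= s.
Hypothesis ee : Num.conj e * e = 1.

Let A := x *m w^t* + e *: (w *m x^t*).

Let wx : w^t* *m x = 0.
Proof. by rewrite -[x]trmxCK -adjmxM xw raddf0 map_mx0. Qed.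

Let adjA : A^t* = w *m x^t* + e^* *: (x *m w^t*).
Proof. by rewrite adjmxD adjmxZ !adjmxM !trmxCK. Qed.

(** Orthogonality of [x] and [w] kills the cross terms, and [ee] removes the phase. *)
Let gram : A^t* *m A = (s ^+ 2)%:C *: (x *m x^t*) + w *m w^t*.
Proof.
rewrite adjA mulmxDl !mulmxDr -!scalemxAl -!scalemxAr.
rewrite !mulmx_mid xx xw wx ww !mulmx1 !mulmx0 !mul0mx mul_mx_scalar.
by rewrite !scaler0 addr0 add0r -scalemxAl !scalerA mulrA ee mul1r addrC.
Qed.

(** The 2 x 2 reduction has zero diagonal and off-diagonal entries [e s^2 = t^2] and 1, so the
    characteristic polynomial is [X^n (X^2 - t^2)]. Leaving [t] free covers both signs of [e]. *)
Lemma eigenvalues_rank2 {t : R[i]} : t ^+ 2 = e * (s ^+ 2)%:C ->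
  perm_eq (eigenvalues A) [:: t, - t & nseq n 0].
Proof.
move=> t2; apply: eigenvalues_perm_eq.
rewrite /A scalemxAl (@char_poly_rank2 _ _ _ _ _ _ 0 (t ^+ 2) 1 0).
- rewrite !big_cons big_nseq subr0 -Monoid.iteropE /= mulrA mulrC.
  congr (_ * _); by rewrite mulr1 polyCN rmorphXn /=; ring.
- by rewrite wx raddf0.
- by rewrite -scalemxAr ww t2 scale_scalar_mx.
- by rewrite xx.
- by rewrite -scalemxAr xw scaler0 raddf0.
Qed.

(** By [gram], the 2 x 2 reduction of [A^* A] is [s^2] times the identity. *)
Lemma singular_values_rank2 :
  perm_eq (singular_values A) [:: s, s & nseq n 0].
Proof.
have /(perm_map (fun z => Num.sqrt (complex.Re z))) :
    perm_eq (eigenvalues (A^t* *m A))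
      [:: (s ^+ 2)%:C, (s ^+ 2)%:C & nseq n 0].
  apply: eigenvalues_perm_eq.
  rewrite gram scalemxAr.
  rewrite (@char_poly_rank2 _ _ _ _ _ _ (s ^+ 2)%:C 0 0 (s ^+ 2)%:C).
  - rewrite !big_cons big_nseq subr0 -Monoid.iteropE /= mulrA mulrC.
    by rewrite mul0r subr0.
  - by rewrite -scalemxAl xx scale_scalar_mx mulr1.
  - by rewrite -scalemxAl xw scaler0 raddf0.
  - by rewrite wx raddf0.
  - by rewrite ww.
by rewrite /= map_nseq sqrtr0 sqrtr_sqr ger0_norm.
Qed.

Let norm2A v : (norm2 (A *m v) ^+ 2)%:C%:M = v^t* *m (A^t* *m A) *m v.
Proof. by rewrite -sqr_norm2 adjmxM !mulmxA. Qed.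

Lemma norm2_rank2_le v : norm2 (A *m v) <= s * norm2 v.
Proof.
(* The main argument divides by [s^2]; for [s = 0] both [w] and [A] vanish. *)
have [s0|s_neq0] := eqVneq s 0.
  have w0 : w = 0 by apply: adjmxM_eq0; rewrite ww s0 expr0n raddf0.
  rewrite s0 mul0r /A w0 raddf0 map_mx0 mulmx0 mul0mx scaler0 addr0 mul0mx.
  by rewrite /norm2 mulmx0 mxE sqrtr0.
have s_gt0 : 0 < s ^+ 2 by rewrite exprn_even_gt0.
rewrite -ler_sqr ?nnegrE ?norm2_ge0 ?mulr_ge0 ?norm2_ge0 // exprMn.
set G := A^t* *m A; set c := (s ^+ 2)%:C.
have cc : Num.conj c = c by exact: conjc_real.
have Gherm : G^t* = G by rewrite /G adjmxM trmxCK.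
have GG : G *m G = c *: G.
  rewrite /G {1}gram -/c mulmxDl -!scalemxAl gram -/c !mulmxDr.
  rewrite -!scalemxAr !mulmx_mid xx xw wx ww -/c !mulmx1 !mulmx0 !mul0mx.
  by rewrite mul_mx_scalar -scalemxAl !scaler0 addr0 add0r -scalerDr.
pose y := c *: v - G *m v.
have : (norm2 y ^+ 2)%:C =
    c * (c * (norm2 v ^+ 2)%:C - (norm2 (A *m v) ^+ 2)%:C).
  apply: (@scalar_mx_inj1 R[i]); rewrite -sqr_norm2.
  rewrite /y (sqr_scale_subM _ cc Gherm GG) sqr_norm2 -norm2A.
  by rewrite scale_scalar_mx -raddfB scale_scalar_mx.
(* The identity is pulled back to the reals, where [|y|^2 >= 0] and [s^2 > 0] give the bound. *)
rewrite -(rmorphM (real_complex R)) -(rmorphB (real_complex R)).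
rewrite -(rmorphM (real_complex R)) => /complexI h.
rewrite -subr_ge0 -(pmulr_rge0 _ s_gt0) -h; exact: sqr_ge0.
Qed.

Lemma operator_norm_rank2 : operator_norm A = s.
Proof.
have norm2x : norm2 x = 1.
  have /matrixP/(_ 0 0) := sqr_norm2 x; rewrite xx !mxE !mulr1n => /esym.
  rewrite -[1]/(1%:C) => /complexI /eqP.
  by rewrite sqrp_eq1 ?norm2_ge0 // => /eqP.
apply/eqP; rewrite eq_le; apply/andP; split.
  (* The upper bound on the supremum needs a nonempty set; the unit vector [x] provides a point. *)
  apply: ge_sup; first by exists (norm2 (A *m x)), x.
  by move=> _ [v /= v1 <-]; rewrite (le_trans (norm2_rank2_le v)) // v1 mulr1.
apply: ub_le_sup.
  exists s => _ [v /= v1 <-].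
  by rewrite (le_trans (norm2_rank2_le v)) // v1 mulr1.
exists x => //; apply/eqP; rewrite -(@eqrXn2 _ 2) ?norm2_ge0 //.
have /matrixP/(_ 0 0) := norm2A x.
rewrite gram mulmxDr mulmxDl -scalemxAr -scalemxAl !mulmxA xx xw !mul0mx addr0.
by rewrite mul1mx xx scale_scalar_mx mulr1 !mxE !mulr1n => /complexI ->.
Qed.

Lemma schatten_rank2 {p : \bar R} : (0 < p)%E ->
  schatten p A = 2 `^ (fine p^-1%E) * s.
Proof.
case: p => [r| |] //=; last first.
  by rewrite powRr0 mul1r => _; exact: operator_norm_rank2.
rewrite lte_fin => r0; rewrite inver gt_eqF //=.
rewrite (perm_big _ singular_values_rank2) !big_cons big_nseq /=.
rewrite powR0 ?gt_eqF // iter_addr addr0 mul0rn addr0.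
exact: powR_inv2.
Qed.

End RankTwo.

(** * The commutator and the arrowhead matrix in rank-two form *)

Definition deviation {R : realType} {d : nat} (psi : 'cV[R[i]]_d)
    (rho : 'M[R[i]]_d) : 'cV[R[i]]_d :=
  rho *m psi - braket psi rho psi *: psi.

(** This is the first column of the off-diagonal part. *)
Definition arrow_tail {R : realType} {d : nat} (psi : 'cV[R[i]]_d.+1)
    (rho U : 'M[R[i]]_d.+1) : 'cV[R[i]]_d.+1 :=
  \col_k if k == 0 then 0 else braket psi rho (col k U).

Lemma delta_cV_unit {C : numClosedFieldType} (d : nat) :
  (delta_mx 0 0 : 'cV[C]_d.+1)^t* *m delta_mx 0 0 = 1%:M :> 'M_1.
Proof.
rewrite [LHS]mx11_scalar mxE (bigD1 0) //= big1 => [|k k0].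
  by rewrite !mxE /= rmorph1 mulr1 addr0.
by rewrite !mxE (negPf k0) mulr0.
Qed.

Lemma delta_arrow_tail {R : realType} {d : nat} (psi : 'cV[R[i]]_d.+1)
    (rho U : 'M[R[i]]_d.+1) :
  (delta_mx 0 0 : 'cV_d.+1)^t* *m arrow_tail psi rho U = 0 :> 'M_1.
Proof.
apply/matrixP => j k; rewrite mxE big1 ?mxE // => l _; rewrite !mxE.
by case: eqP => _; rewrite ?mulr0 //= (rmorph0 Num.conj) mul0r.
Qed.

Section Arrowhead.
Context {R : realType} {n : nat} {psi : 'cV[R[i]]_n.+2}.
Context {rho U : 'M[R[i]]_n.+2} {s : R}.
Hypothesis psi_unit : psi^t* *m psi = 1%:M.
Hypothesis rho_herm : rho^t* = rho.
Hypothesis arrowU : arrowhead_basis psi rho U.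
Hypothesis var_s : (s ^+ 2)%:C = variance psi rho.

Let F := braket psi rho psi.
Let F_mx : psi^t* *m rho *m psi = F%:M.
Proof. exact: mx11_scalar. Qed.

Let conjF : Num.conj F = F.
Proof.
have : (psi^t* *m rho *m psi)^t* = psi^t* *m rho *m psi.
  by rewrite !adjmxM trmxCK rho_herm mulmxA.
by rewrite F_mx => /matrixP/(_ 0 0); rewrite !mxE !mulr1n.
Qed.

Let sqr_mx : psi^t* *m rho *m rho *m psi = ((s ^+ 2)%:C + F ^+ 2)%:M.
Proof.
rewrite var_s subrK [LHS]mx11_scalar -(mulmxA _ rho rho).
reflexivity.
Qed.

(** Subtracting [F psi] from [rho psi] changes nothing: as [F] is real, the two extra multiples of
    [psi psi^*] cancel. *)
Lemma commutator_rank2 : commutator (projector psi) rho =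
  psi *m (deviation psi rho)^t* + (-1) *: (deviation psi rho *m psi^t*).
Proof.
rewrite /commutator /projector /deviation adjmxB adjmxZ adjmxM.
rewrite rho_herm conjF mulmxBr mulmxBl -scalemxAr -scalemxAl scaleN1r.
by rewrite !mulmxA opprB addrA subrK.
Qed.

Lemma adj_psi_deviation : psi^t* *m deviation psi rho = 0.
Proof.
rewrite mulmxBr -scalemxAr mulmxA F_mx psi_unit scale_scalar_mx mulr1.
by rewrite subrr.
Qed.

(** Since [psi] is orthogonal to the deviation, only [psi^* rho] times the deviation remains, which
    is [psi^* rho^2 psi - F^2]. *)
Lemma sqr_deviation :
  (deviation psi rho)^t* *m deviation psi rho = ((s ^+ 2)%:C)%:M.
Proof.
rewrite {1}/deviation adjmxB adjmxZ adjmxM rho_herm conjF.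
rewrite mulmxBl -scalemxAl adj_psi_deviation scaler0 subr0.
rewrite mulmxBr -scalemxAr F_mx mulmxA sqr_mx scale_scalar_mx.
by rewrite -raddfB /= expr2 addrK.
Qed.

(** The phase convention makes the entries [C_k] real, so conjugating the tail in the first row has
    no effect. *)
Lemma arrowhead_rank2 : arrowhead_offdiag psi rho U =
  delta_mx 0 0 *m (arrow_tail psi rho U)^t* +
  1 *: (arrow_tail psi rho U *m (delta_mx 0 0 : 'cV_n.+2)^t*).
Proof.
have [_ _ _ C_ge0] := arrowU.
have C_real k : k != 0 -> Num.conj (braket psi rho (col k U)) =
    braket psi rho (col k U).
  by move=> k0; apply/conj_Creal/ger0_real/C_ge0/eqP.
rewrite scale1r; apply/matrixP => j k; rewrite [RHS]mxE !(mxE, big_ord1).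
case: (altP (j =P 0)) => [->|j0]; case: (altP (k =P 0)) => [->|k0] /=.
- by rewrite rmorph0 mulr0 add0r mul0r.
- rewrite (k0 : (k != 0 :> nat) = true) C_real //.
  by rewrite mul1r mul0r addr0.
- rewrite (j0 : (j != 0 :> nat) = true) rmorph1.
  by rewrite andbF mul0r add0r mulr1.
- rewrite (negPf j0 : (j == 0 :> nat) = false).
  rewrite (negPf k0 : (k == 0 :> nat) = false) /=.
  by rewrite mul0r add0r (rmorph0 Num.conj) mulr0.
Qed.

(** Parseval: [U] is unitary, so the row [psi^* rho U] has squared norm
    [psi^* rho^2 psi = s^2 + F^2]. Its entry at 0 is [F], and removing it leaves the tail. *)
Lemma sqr_arrow_tail :
  (arrow_tail psi rho U)^t* *m arrow_tail psi rho U = ((s ^+ 2)%:C)%:M.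
Proof.
have [/unitarymxP UU U0 _ _] := arrowU.
pose r := psi^t* *m rho *m U.
have rE k : r 0 k = braket psi rho (col k U).
  by rewrite /r /braket colE mulmxA -colE [RHS]mxE.
have : r *m r^t* = ((s ^+ 2)%:C + F ^+ 2)%:M.
  rewrite /r !adjmxM trmxCK rho_herm mulmxA -(mulmxA _ U) UU mulmx1.
  by rewrite mulmxA sqr_mx.
have -> : r *m r^t* = (\sum_k Num.conj (r 0 k) * r 0 k)%:M.
  rewrite [LHS]mx11_scalar mxE; congr (_%:M); apply: eq_bigr => k _.
  by rewrite mulrC mxE [_^T _ _]mxE.
move=> /scalar_mx_inj1; rewrite (bigD1 0) //= rE U0 // -/F conjF -expr2 addrC.
move=> /addIr <-; rewrite [LHS]mx11_scalar mxE (bigD1 0) //=; congr (_%:M).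
rewrite [arrow_tail _ _ _ 0 0]mxE mulr0 add0r; apply: eq_bigr => k k0.
by rewrite rE !mxE (negPf k0).
Qed.

End Arrowhead.

Local Close Scope sesquilinear_scope.

Theorem mainTheorem4 (R : realType) (d : nat) (hd : (2 <= d)%N)
    (psi : 'cV[R[i]]_d) (hpsi : norm2 psi = 1)
    (rho : 'M[R[i]]_d) (hrho : density_matrix rho)
    (U : 'M[R[i]]_d) (hU : arrowhead_basis psi rho U)
    (sigma : R) (hsigma : 0 <= sigma)
    (hvar : (sigma ^+ 2)%:C = variance psi rho) :
  let C := arrowhead_offdiag psi rho U in
  let K := commutator (projector psi) rho in
  [/\ perm_eq (eigenvalues C)
        [:: sigma%:C, - sigma%:C & nseq (d - 2) 0],
      perm_eq (eigenvalues K)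
        [:: 'i * sigma%:C, - ('i * sigma%:C) & nseq (d - 2) 0]
    & forall p : \bar R, (0 < p)%E ->
        schatten p K = schatten p C /\
        schatten p C = 2 `^ (fine p^-1%E) * sigma].
Proof.
case: d hd psi hpsi rho hrho U hU hvar => [|[|n]].
- by [].
- by [].
move=> _ {}psi psi1 {}rho.
move=> [[/is_hermitianmxP rho_herm _] _] {}U arrowU var_s /=.
(* Hermitian symmetry is encoded with a sign factor [(-1) ^+ 0], removed here. *)
have {}rho_herm : map_mx Num.conj rho^T = rho.
  by rewrite {2}rho_herm expr0 scale1r.
have psi_unit : map_mx Num.conj psi^T *m psi = 1%:M.
  by rewrite sqr_norm2 psi1 expr1n.
have conjN1 : Num.conj (-1) * -1 = 1 :> R[i] by rewrite rmorphN1 mulrNN mulr1.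
have conj1 : Num.conj 1 * 1 = 1 :> R[i] by rewrite rmorph1 mulr1.
(* The values of [t]: [i sigma] for the commutator, where [e = -1], and [sigma] for [C], where
   [e = 1]. *)
have iK : ('i * sigma%:C) ^+ 2 = -1 * (sigma ^+ 2)%:C :> R[i].
  by rewrite exprMn sqr_i rmorphXn.
have sK : sigma%:C ^+ 2 = 1 * (sigma ^+ 2)%:C :> R[i].
  by rewrite mul1r rmorphXn.
have xw := adj_psi_deviation (rho := rho) psi_unit.
have ww := sqr_deviation psi_unit rho_herm var_s.
have ex := sqr_arrow_tail rho_herm arrowU var_s.
rewrite (commutator_rank2 rho_herm) (arrowhead_rank2 arrowU) subSS subn1 /=.
split.
- exact: (eigenvalues_rank2 (delta_cV_unit _) (delta_arrow_tail _ _ _) ex sK).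
- exact: (eigenvalues_rank2 psi_unit xw ww iK).
- move=> p p0.
  have nK := schatten_rank2 psi_unit xw ww hsigma conjN1 p0.
  have nC := schatten_rank2 (delta_cV_unit _) (delta_arrow_tail _ _ _) ex
    hsigma conj1 p0.
  by split; [exact: etrans nK (esym nC) | exact: nC].
Qed.
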